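(* Let $d\ge2$, $I=-e^1e^2$, $E=e^0$ in $C\ell_{1,2d}$, and consider either of the two cases (semi-spinor) $J=\{0,1,2,3,5,7,\dots,2d-1\}$, $K=\{3,5,\dots,2d-3,2d-1\}$; (double spinor) $J=\{0,1,2,3,5,7,\dots,2d-1,2d\}$, $K=\{3,5,\dots,2d-3\}$. Let $Q'=C\ell(e^\mu:\mu\in J)\subset C\ell_{1,2d}$ be the subalgebra generated by the generators with index in $J$. Let $P=(p^\mu_\nu)\in\mathrm{SO}(1,2d)$, $Q=(q^\nu_\mu)=P^{-1}$, and define ($\mu,\nu=0,\dots,2d$) $$\widehat{x^\mu}=p^\mu_\nu x^\nu,\qquad \widehat\partial_\mu=q^\nu_\mu\partial_\nu,\qquad \widehat a_\mu=q^\nu_\mu a_\nu,\qquad \widehat{e^\mu}=e^\mu .$$ Let $S\in\mathrm{Spin}(1,2d)$ be related to $P$ by $S^{-1}e^\mu S=p^\mu_\nu e^\nu$ for $\mu=0,\dots,2d$, and write $S=S^0+\sum_k S_{\mu_1\mu_2\ldots\mu_k}e^{\mu_1\mu_2\ldots\mu_k}$ for its decomposition with coefficients in $Q'$ described in the context. If $\Psi:\mathbb{R}^{1,2d}\to Q'^{(0)}$ is a solution of the Dirac--Hestenes equation $$\sum_{\mu\in J}e^\mu(\partial_\mu\Psi+\Psi a_\mu I)E+\sum_{\mu\in K}(\partial_{\mu+1}\Psi+\Psi a_{\mu+1}I)e^\mu EI+m\Psi I=0,$$ then the function $$\widehat\Psi=S^0\Psi+\sum_k S_{\mu_1\mu_2\ldots\mu_k}\Psi\,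 e^{\mu_1-1\,\mu_2-1\,\ldots\,\mu_k-1}I^k$$ is a solution of the transformed Dirac--Hestenes equation $$\sum_{\mu\in J}\widehat{e^\mu}\,\widehat A_\mu E+\sum_{\mu\in K}\widehat A_{\mu+1}I\,\widehat{e^\mu}E+m\widehat\Psi I=0,\qquad \widehat A_\mu:=\widehat\partial_\mu\widehat\Psi+\widehat\Psi\,\widehat a_\mu I .$$
   Context: $C\ell_{1,n}$ is the real Clifford algebra with identity $e$ and generators $e^0,\dots,e^n$ satisfying $e^\mu e^\nu+e^\nu e^\mu=2\eta^{\mu\nu}e$, $\eta=\mathrm{diag}(1,-1,\dots,-1)$; here $n=2d$. $C\ell^{(0)}_{1,n}$ and $C\ell^{(1)}_{1,n}$ are the spans of products of an even, resp. odd, number of distinct generators; $C\ell^1_{1,n}$ is the span of the generators; a superscript $\times$ denotes invertible elements; $e^{\nu_1\nu_2\ldots\nu_k}=e^{\nu_1}e^{\nu_2}\cdots e^{\nu_k}$. $Q'^{(0)}=Q'\cap C\ell^{(0)}_{1,n}$ and $Q'^{(1)}=Q'\cap C\ell^{(1)}_{1,n}$. $\widetilde U$ denotes reversion (the linear anti-automorphism fixing the generators). $$\mathrm{Spin}(1,n)=\{T\in C\ell^{(0)\times}_{1,n}:\ TxT^{-1}\in C\ell^1_{1,n}\ \forall x\in C\ell^1_{1,n},\ T^{-1}=\pm\widetilde T\}.$$ $\mathrm{SO}(1,n)=\{A\in\mathrm{Mat}(n+1,\mathbb{R}):A^\top\eta A=\eta,\ \det A=1\}$. In $p^\mu_\nu$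 and $q^\nu_\mu$ the upper index is the row index and the lower one the column index, so $q^\alpha_\mu p^\mu_\nu=\delta^\alpha_\nu$; repeated indices are summed. Decomposition of $S$: every $S\in C\ell^{(0)}_{1,n}$ is written uniquely as $S=S^0+\sum_{k\ge1}\sum_{\mu_1<\dots<\mu_k}S_{\mu_1\ldots\mu_k}e^{\mu_1\ldots\mu_k}$, where $\mu_1,\dots,\mu_k$ run over the indices of generators not among those generating $Q'$ (i.e. $\mu_i\in\{4,6,\dots,2d\}$ in the semi-spinor case, $\mu_i\in\{4,6,\dots,2d-2\}$ in the double spinor case), $S^0\in Q'^{(0)}$, and $S_{\mu_1\ldots\mu_k}$ is in $Q'^{(0)}$ for $k$ even and in $Q'^{(1)}$ for $k$ odd. The sum $\sum_k$ in the statement is over all such increasing multi-indices, and $e^{\mu_1-1\,\ldots\,\mu_k-1}=e^{\mu_1-1}\cdots e^{\mu_k-1}$. $\mathbb{R}^{1,n}$ is $\mathbb{R}^{n+1}$ with coordinates $x^0,\dots,x^n$ and metric $\eta$; $\partial_\mu=\partial/\partial x^\mu$; $m$ is a real constant (mass); $\mathbf a=(a_0,\dots,a_n):\mathbb{R}^{1,n}\to\mathbb{R}^{n+1}$ is a given vector-potential; $\Psi$ is differentiable. Untransformed functions are evaluated at $x$ and hatted functions at $\widehat x=Px$ (e.g. $\widehat a_\mu(\widehat x)=q^\nu_\mu a_\nu(x)$, and $\widehat\Psi(\widehat x)$ is given by the formula with $\Psi=\Psi(x)$); $\widehat\partial_\mu=\partial/\partial\widehat{x^\mu}$. *)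

(* Defs.v *)
From HB Require Import structures.
From mathcomp Require Import all_boot all_order all_algebra.
From mathcomp Require Import falgebra.
From mathcomp Require boolp.
From mathcomp Require Import reals topology normedtype derive.

Set Implicit Arguments.
Unset Strict Implicit.
Unset Printing Implicit Defensive.

Import Order.TTheory GRing.Theory Num.Theory.
Import numFieldNormedType.Exports.

Local Open Scope ring_scope.

(* The real Clifford algebra of signature (1,n).  An element is its family of
   coordinates on the basis of ordered products e^{i_1} ... e^{i_k},
   i_1 < ... < i_k, indexed by the set {i_1, ..., i_k}; see [bladeE]. *)
Definition Clifford (R : realType) (n : nat) := {ffun {set 'I_n.+1} -> R^o}.

HB.instance Definition _ (R : realType) (n : nat) :=
  Vector.copy (Clifford R n) {ffun {set 'I_n.+1} -> R^o}.

Definition eta_diag (R : realType) (n : nat) : 'rV[R]_n.+1 :=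
  \row_i (if i == ord0 then 1 else - 1).

Definition eta (R : realType) (n : nat) : 'M[R]_n.+1 := diag_mx (eta_diag R n).

Section CliffordAlgebra.
Variables (R : realType) (n : nat).
Implicit Types (A B C D M : {set 'I_n.+1}) (x y z : Clifford R n).

Definition symdiff A B : {set 'I_n.+1} := (A :\: B) :|: (B :\: A).

Lemma in_symdiff A B i : (i \in symdiff A B) = (i \in A) (+) (i \in B).
Proof. by rewrite !inE; case: (i \in A); case: (i \in B). Qed.

Lemma symdiffK A : involutive (symdiff A).
Proof. by move=> B; apply/setP=> i; rewrite !in_symdiff addKb. Qed.

Definition gsign (i j : 'I_n.+1) : R :=
  if (j < i)%N then - 1 else if i == j then eta_diag R n 0 i else 1.

(* e^A e^B = bsign A B e^(A (+) B): each pair with i > j costs a transposition,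
   each common index i a factor (e^i)^2 *)
Definition bsign A B : R := \prod_(i in A) \prod_(j in B) gsign i j.

Lemma eta_diag_sq i : eta_diag R n 0 i * eta_diag R n 0 i = 1.
Proof. by rewrite mxE; case: ifP => _; rewrite ?mulrNN mulr1. Qed.

Lemma gsign_sq i j : gsign i j * gsign i j = 1.
Proof.
rewrite /gsign; case: ifP => _; first by rewrite mulrNN mulr1.
by case: ifP => _; rewrite ?eta_diag_sq ?mulr1.
Qed.

Lemma bsign_sq A B : bsign A B * bsign A B = 1.
Proof.
rewrite -big_split /= big1 // => i _; rewrite -big_split /= big1 // => j _.
exact: gsign_sq.
Qed.

Lemma bsignDl A B C : bsign (symdiff A B) C = bsign A C * bsign B C.
Proof.
have sq i : \prod_(j in C) gsign i j * \prod_(j in C) gsign i j = 1.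
  by rewrite -big_split /= big1 // => j _; exact: gsign_sq.
rewrite /bsign big_mkcond [in RHS]big_mkcond [X in _ * X]big_mkcond.
rewrite -big_split; apply: eq_bigr => i _; rewrite in_symdiff.
by case: (i \in A); case: (i \in B); rewrite /= ?sq ?mul1r ?mulr1.
Qed.

Lemma bsignDr A B C : bsign C (symdiff A B) = bsign C A * bsign C B.
Proof.
rewrite /bsign -big_split; apply: eq_bigr => i _ /=.
rewrite big_mkcond [in RHS]big_mkcond [X in _ * X]big_mkcond.
rewrite -big_split; apply: eq_bigr => j _; rewrite in_symdiff.
by case: (j \in A); case: (j \in B);
  rewrite /= ?gsign_sq ?mul1r ?mulr1.
Qed.

Definition cmul x y : Clifford R n :=
  [ffun C => \sum_A bsign A (symdiff A C) * (x A * y (symdiff A C))].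

Definition cbasis A : Clifford R n := [ffun B => (B == A)%:R].

Lemma bsign0l A : bsign set0 A = 1.
Proof. by rewrite /bsign big_set0. Qed.

Lemma bsign0r A : bsign A set0 = 1.
Proof. by rewrite /bsign big1 // => i _; rewrite big_set0. Qed.

Lemma symdiff0l A : symdiff set0 A = A.
Proof. by apply/setP=> i; rewrite in_symdiff inE. Qed.

Lemma symdiff0r A : symdiff A set0 = A.
Proof. by apply/setP=> i; rewrite in_symdiff inE addbF. Qed.

Lemma symdiffv A : symdiff A A = set0.
Proof. by apply/setP=> i; rewrite in_symdiff inE addbb. Qed.

Lemma symdiffA A B C : symdiff A (symdiff B C) = symdiff (symdiff A B) C.
Proof. by apply/setP=> i; rewrite !in_symdiff addbA. Qed.

Lemma symdiffC A B : symdiff A B = symdiff B A.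
Proof. by apply/setP=> i; rewrite !in_symdiff addbC. Qed.

Fact cmulA : associative cmul.
Proof.
move=> x y z; apply/ffunP=> D; rewrite !ffunE.
under eq_bigr => A _ do
  rewrite ffunE !mulr_sumr (reindex_inj (can_inj (symdiffK A))).
rewrite exchange_big; apply: eq_bigr => C _; rewrite ffunE mulr_suml mulr_sumr.
apply: eq_bigr => A _ /=.
have -> : symdiff (symdiff A C) (symdiff A D) = symdiff C D.
  by rewrite [symdiff A C]symdiffC -symdiffA symdiffK.
suff sgnE : bsign A (symdiff A D) * bsign (symdiff A C) (symdiff C D)
    = bsign C (symdiff C D) * bsign A (symdiff A C).
  rewrite [LHS](_ : _ = (bsign A (symdiff A D) *
      bsign (symdiff A C) (symdiff C D)) *
      (x A * y (symdiff A C) * z (symdiff C D))).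
    by rewrite sgnE -!mulrA.
  by rewrite -!mulrA; congr (_ * _); rewrite mulrCA.
rewrite bsignDl !bsignDr.
rewrite [LHS](_ : _ = bsign A A * bsign A C * (bsign A D * bsign A D)
   * (bsign C C * bsign C D)).
  by rewrite bsign_sq mulr1 mulrC.
by rewrite -!mulrA; congr (_ * _); rewrite mulrCA.
Qed.

Fact cmul1l : left_id (cbasis set0) cmul.
Proof.
move=> x; apply/ffunP=> C; rewrite !ffunE (bigD1 set0) //= big1.
  by rewrite ffunE eqxx bsign0l symdiff0l !mul1r addr0.
by move=> A /negbTE A0; rewrite ffunE A0 mul0r mulr0.
Qed.

Fact cmul1r : right_id (cbasis set0) cmul.
Proof.
move=> x; apply/ffunP=> C; rewrite !ffunE (bigD1 C) //= big1.
  by rewrite ffunE symdiffv eqxx bsign0r mulr1 mul1r addr0.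
move=> A AC; rewrite ffunE [_ == set0](_ : _ = false) ?mulr0 //.
apply: contraNF AC => /eqP AC0.
by rewrite -(symdiffK A C) AC0 symdiff0r.
Qed.

Fact cmulDl : left_distributive cmul +%R.
Proof.
move=> x y z; apply/ffunP=> C; rewrite !ffunE -big_split.
by apply: eq_bigr => A _; rewrite ffunE mulrDl mulrDr.
Qed.

Fact cmulDr : right_distributive cmul +%R.
Proof.
move=> x y z; apply/ffunP=> C; rewrite !ffunE -big_split.
by apply: eq_bigr => A _; rewrite ffunE !mulrDr.
Qed.

Fact cone_neq0 : cbasis set0 != 0.
Proof.
apply/eqP=> /ffunP/(_ set0); rewrite !ffunE eqxx => /eqP.
by rewrite oner_eq0.
Qed.

End CliffordAlgebra.

HB.instance Definition _ (R : realType) (n : nat) :=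
  GRing.Zmodule_isNzRing.Build (Clifford R n) (@cmulA R n) (@cmul1l R n)
    (@cmul1r R n) (@cmulDl R n) (@cmulDr R n) (@cone_neq0 R n).

Fact cscaleAl (R : realType) (n : nat) (k : R) (x y : Clifford R n) :
  k *: (x * y) = k *: x * y.
Proof.
apply/ffunP=> C; rewrite !ffunE scaler_sumr; apply: eq_bigr => A _.
by rewrite ffunE /GRing.scale /= mulrCA !mulrA.
Qed.

HB.instance Definition _ (R : realType) (n : nat) :=
  GRing.Lmodule_isLalgebra.Build R (Clifford R n) (@cscaleAl R n).

Fact cscaleAr (R : realType) (n : nat) (k : R) (x y : Clifford R n) :
  k *: (x * y) = x * (k *: y).
Proof.
apply/ffunP=> C; rewrite !ffunE scaler_sumr; apply: eq_bigr => A _.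
by rewrite ffunE /GRing.scale /= mulrCA; congr (_ * _); rewrite mulrCA.
Qed.

HB.instance Definition _ (R : realType) (n : nat) :=
  GRing.Lalgebra_isAlgebra.Build R (Clifford R n) (@cscaleAr R n).

HB.instance Definition _ (R : realType) (n : nat) :=
  Algebra_isFalgebra.Build R (Clifford R n).

Definition gen {R : realType} {n : nat} (i : 'I_n.+1) : Clifford R n :=
  cbasis R [set i].

Definition blade {R : realType} {n : nat} (A : {set 'I_n.+1}) : Clifford R n :=
  \prod_(i <- enum A) gen i.

Lemma cbasisM (R : realType) (n : nat) (A B : {set 'I_n.+1}) :
  cbasis R A * cbasis R B = bsign R A B *: cbasis R (symdiff A B).
Proof.
apply/ffunP=> C; rewrite !ffunE (bigD1 A) //= big1 ?addr0; last first.
  by move=> D /negbTE DA; rewrite ffunE DA mul0r mulr0.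
rewrite !ffunE eqxx mul1r -[C == _](inj_eq (can_inj (symdiffK A))) symdiffK.
by case: eqP => [->|_]; rewrite ?mulr0 // /GRing.scale /= mulr0.
Qed.

Lemma gen_rel (R : realType) (n : nat) (mu nu : 'I_n.+1) :
  gen mu * gen nu + gen nu * gen mu = (2 * eta R n mu nu)%:A.
Proof.
rewrite /gen !cbasisM /bsign !big_set1 /gsign /eta !mxE.
rewrite [symdiff [set nu] _]symdiffC.
case: (ltngtP mu nu) => [lt|lt|/val_inj->].
- by rewrite -!val_eqE (ltn_eqF lt) mulr0n mulr0 scale0r scale1r scaleN1r
    subrr.
- by rewrite -!val_eqE (ltn_eqF lt) (gtn_eqF lt) mulr0n mulr0 scale0r
    scale1r scaleN1r addNr.
by rewrite eqxx symdiffv -scalerDl mulr1n mulr_natl mulr2n.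
Qed.

Lemma bladeE (R : realType) (n : nat) (A : {set 'I_n.+1}) :
  blade A = cbasis R A.
Proof.
suff main (s : seq 'I_n.+1) : sorted ltn (map val s) ->
    \prod_(i <- s) gen i = cbasis R [set i in s].
  rewrite /blade main; last first.
    apply: (subseq_sorted ltn_trans) (iota_ltn_sorted 0 n.+1).
    by rewrite -val_enum_ord map_subseq // [enum 'I__]enumT filter_subseq.
  by congr cbasis; apply/setP=> i; rewrite inE mem_enum.
elim: s => [|i s IH] /=.
  by rewrite big_nil => _; congr cbasis; apply/setP=> j; rewrite !inE.
rewrite (path_sortedE ltn_trans) => /andP[/allP lti srt].
have ltis j : j \in s -> (i < j)%N by move=> js; apply: lti; rewrite map_f.
rewrite big_cons IH // cbasisM [bsign _ _ _](_ : _ = 1).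
  rewrite scale1r; congr cbasis; apply/setP=> j.
  rewrite in_symdiff !inE; case: eqP => [->|//].
  by case: (boolP (i \in s)) => // /ltis; rewrite ltnn.
rewrite /bsign big_set1 big1 // => j; rewrite inE => /ltis ij.
by rewrite /gsign ltnNge (ltnW ij) /= -val_eqE (ltn_eqF ij).
Qed.

Definition reversion {R : realType} {n : nat} (x : Clifford R n) :
    Clifford R n :=
  \sum_A x A *: \prod_(i <- rev (enum A)) gen i.

Definition Cl_even (R : realType) (n : nat) : {vspace Clifford R n} :=
  <<[seq blade A | A <- enum [set A : {set 'I_n.+1} | ~~ odd #|A| ]]>>%VS.

Definition Cl_odd (R : realType) (n : nat) : {vspace Clifford R n} :=
  <<[seq blade A | A <- enum [set A : {set 'I_n.+1} | odd #|A| ]]>>%VS.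

Definition Cl_vec (R : realType) (n : nat) : {vspace Clifford R n} :=
  <<[seq gen i | i <- enum 'I_n.+1]>>%VS.

Definition Cl_sub (R : realType) (n : nat) (J : {set 'I_n.+1}) :
    {vspace Clifford R n} :=
  agenv <<[seq gen i | i <- enum J]>>%VS.

Definition Cl_sub_even (R : realType) (n : nat) (J : {set 'I_n.+1}) :
    {vspace Clifford R n} :=
  (Cl_sub R J :&: Cl_even R n)%VS.

Definition Cl_sub_odd (R : realType) (n : nat) (J : {set 'I_n.+1}) :
    {vspace Clifford R n} :=
  (Cl_sub R J :&: Cl_odd R n)%VS.

Definition in_Spin {R : realType} {n : nat} (T : Clifford R n) : Prop :=
  [/\ T \in Cl_even R n, T \is a GRing.unit,
      forall x, x \in Cl_vec R n -> T * x * T^-1 \in Cl_vec R n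
    & T^-1 = reversion T \/ T^-1 = - reversion T].

Definition in_SO {R : realType} {n : nat} (A : 'M[R]_n.+1) : Prop :=
  A^T *m eta R n *m A = eta R n /\ \det A = 1.

(* A set M of indices outside J encodes the multi-index of its elements in
   increasing order; c set0 is S^0. *)
Definition is_decomposition {R : realType} {n : nat} (J : {set 'I_n.+1})
    (S : Clifford R n) (c : {set 'I_n.+1} -> Clifford R n) : Prop :=
  (forall M : {set 'I_n.+1}, M \subset ~: J ->
     c M \in if odd #|M| then Cl_sub_odd R J else Cl_sub_even R J)
  /\ S = c set0 + \sum_(M : {set 'I_n.+1} | (M \subset ~: J) && (M != set0)) c M * blade M.

Definition bivI {R : realType} {n : nat} : Clifford R n :=
  - (gen (inord 1) * gen (inord 2)).

Definition vecE {R : realType} {n : nat} : Clifford R n := gen ord0.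

Definition hat_Psi {R : realType} {n : nat} (J : {set 'I_n.+1})
    (P : 'M[R]_n.+1) (c : {set 'I_n.+1} -> Clifford R n)
    (Psi : 'cV[R]_n.+1 -> Clifford R n) (xhat : 'cV[R]_n.+1) : Clifford R n :=
  let x := invmx P *m xhat in
  c set0 * Psi x
  + \sum_(M : {set 'I_n.+1} | (M \subset ~: J) && (M != set0))
      c M * Psi x * (\prod_(i <- enum M) gen (inord i.-1)) * bivI ^+ #|M|.

Definition hat_a {R : realType} {n : nat} (P : 'M[R]_n.+1)
    (a : 'cV[R]_n.+1 -> 'rV[R]_n.+1) (xhat : 'cV[R]_n.+1) : 'rV[R]_n.+1 :=
  let x := invmx P *m xhat in
  \row_mu \sum_nu invmx P nu mu * a x 0 nu.

(* Clifford-valued functions are differentiated coordinatewise in the basis of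
   blades. *)
Definition Cl_differentiable {R : realType} {n : nat}
    (f : 'cV[R]_n.+1 -> Clifford R n) : Prop :=
  forall (A : {set 'I_n.+1}) (x : 'cV[R]_n.+1),
    differentiable (fun y => f y A : R) x.

Definition partial {R : realType} {n : nat} (mu : 'I_n.+1)
    (f : 'cV[R]_n.+1 -> Clifford R n) (x : 'cV[R]_n.+1) : Clifford R n :=
  [ffun A => 'D_(delta_mx mu 0) (fun y => f y A : R) x].

Definition covD {R : realType} {n : nat} (a : 'cV[R]_n.+1 -> 'rV[R]_n.+1)
    (f : 'cV[R]_n.+1 -> Clifford R n) (mu : 'I_n.+1) (x : 'cV[R]_n.+1) :
    Clifford R n :=
  partial mu f x + a x 0 mu *: (f x * bivI).

(* With respect to the coordinates xhat = P x, the operator q^nu_mu d/dx^nu is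
   the partial derivative d/dxhat^mu; so [covD] also serves for the hatted
   equation. *)
Lemma partial_hat (R : realType) (n : nat) (P : 'M[R]_n.+1)
    (f : 'cV[R]_n.+1 -> Clifford R n) (mu : 'I_n.+1) (x : 'cV[R]_n.+1) :
  P \in unitmx -> Cl_differentiable f ->
  partial mu f (P *m x) =
    \sum_nu invmx P nu mu *: partial nu (fun y => f (P *m y)) x.
Proof.
move=> Pu df; apply/ffunP=> A; rewrite sum_ffunE ffunE.
have dfA := df A (P *m x).
have DE v : 'D_v (fun y => f (P *m y) A : R) x
    = 'D_(P *m v) (fun y => f y A : R) (P *m x).
  rewrite /derive; apply: (congr1 (fun g => lim (nbhs (fmap g _)))).
  by apply/boolp.funext => h /=; rewrite mulmxDr scalemxAr.
have {1}-> : delta_mx mu 0 = \sum_nu invmx P nu mu *: (P *m delta_mx nu 0)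
    :> 'cV[R]_n.+1.
  under eq_bigr => nu _ do rewrite scalemxAr.
  rewrite -mulmx_sumr.
  have -> : \sum_nu invmx P nu mu *: delta_mx nu 0 = col mu (invmx P).
    by rewrite [RHS]matrix_sum_delta; apply: eq_bigr => nu _;
      rewrite big_ord1 !mxE.
  by rewrite colE mulmxA mulmxV // mul1mx.
rewrite deriveE // linear_sum; apply: eq_bigr => nu _.
by rewrite !ffunE DE linearZ deriveE.
Qed.

Inductive spinor_case := SemiSpinor | DoubleSpinor.

Definition index_J (sc : spinor_case) (d : nat) : {set 'I_(2 * d).+1} :=
  [set i : 'I_(2 * d).+1 | match sc with
    | SemiSpinor => (i <= 2)%N || odd i
    | DoubleSpinor => [|| (i <= 2)%N, odd i | (i : nat) == (2 * d)%N]
    end].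

Definition index_K (sc : spinor_case) (d : nat) : {set 'I_(2 * d).+1} :=
  [set i : 'I_(2 * d).+1 | [&& odd i, (3 <= i)%N & match sc with
    | SemiSpinor => (i <= 2 * d - 1)%N
    | DoubleSpinor => (i <= 2 * d - 3)%N
    end]].

Definition Dirac_Hestenes {R : realType} (sc : spinor_case) (d : nat) (m : R)
    (a : 'cV[R]_((2 * d).+1) -> 'rV[R]_((2 * d).+1))
    (Psi : 'cV[R]_((2 * d).+1) -> Clifford R (2 * d)) : Prop :=
  forall x,
    \sum_(mu in index_J sc d) gen mu * covD a Psi mu x * vecE
    + \sum_(mu in index_K sc d)
        covD a Psi (inord mu.+1) x * gen mu * vecE * bivI
    + m *: (Psi x * bivI) = 0.

Definition transformed_Dirac_Hestenes {R : realType} (sc : spinor_case)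
    (d : nat) (m : R) (a : 'cV[R]_((2 * d).+1) -> 'rV[R]_((2 * d).+1))
    (Psi : 'cV[R]_((2 * d).+1) -> Clifford R (2 * d)) : Prop :=
  forall x,
    \sum_(mu in index_J sc d) gen mu * covD a Psi mu x * vecE
    + \sum_(mu in index_K sc d)
        covD a Psi (inord mu.+1) x * bivI * gen mu * vecE
    + m *: (Psi x * bivI) = 0.

Definition differentiable_spinor {R : realType} (sc : spinor_case) (d : nat)
    (Psi : 'cV[R]_((2 * d).+1) -> Clifford R (2 * d)) : Prop :=
  Cl_differentiable Psi
  /\ forall x, Psi x \in Cl_sub_even R (index_J sc d).

(* Main.v *)
(** Put I = bivI, L = ~: J and let xi be the product over i in L of
    1 + I e^{i-1} e^i.  Since (I e^{i-1} e^i)^2 = 1, we have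
    e^i xi = e^{i-1} I xi for i in L; moreover I and E commute with xi, and
    X xi = 0 forces X = 0 for X in Q'.  An even element of Q' commutes with
    every e^i, i in L, so the function hat Psi is the one with values in Q'
    such that hat Psi * xi = S Psi xi, and the left hand side of the
    Dirac--Hestenes equation, times xi, is
    (sum of e^mu A_mu xi over all mu) E + m Psi xi I.
    The relation e^mu S = S p^mu_nu e^nu then shows that the left hand side of
    the hatted equation, times xi, is S times that of the original one. *)

Require Import Defs.
From HB Require Import structures.
From mathcomp Require Import all_boot all_order all_algebra.
From mathcomp Require Import falgebra.
From mathcomp Require boolp.
From mathcomp Require Import functions.
From mathcomp Require Import reals topology normedtype derive.
From mathcomp Require Import zify.
Import GRing.Theory Num.Theory numFieldNormedType.Exports.
Local Open Scope ring_scope.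

Set Implicit Arguments.
Unset Strict Implicit.
Unset Printing Implicit Defensive.

(** * Coordinates in the basis of blades *)

Section Coordinates.
Variables (R : realType) (n : nat).
Implicit Types (A B C D J : {set 'I_n.+1}) (x y z : Clifford R n).

Lemma clifford_sum_cbasis x : x = \sum_A (x A : R) *: cbasis R A.
Proof.
apply/ffunP=> B; rewrite sum_ffunE (bigD1 B) //= big1 => [|A AB].
  by rewrite !ffunE eqxx addr0 /GRing.scale /= mulr1.
by rewrite !ffunE eq_sym (negbTE AB) scaler0.
Qed.

(** Parity and membership in a subalgebra are both treated as conditions on which blades may have a
    nonzero coordinate. *)
Definition supported (p : pred {set 'I_n.+1}) x :=
  forall A, ~~ p A -> x A = 0.

Lemma mem_span_blade (D : {set {set 'I_n.+1}}) x :
  x \in <<[seq blade A | A <- enum D]>>%VS <-> supported (fun A => A \in D) x.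
Proof.
split=> [xD A AD|xD].
  rewrite (@coord_span _ _ _ (in_tuple _) _ xD) sum_ffunE big1 // => i _.
  rewrite ffunE (nth_map set0) ?bladeE ?ffunE; last first.
    by rewrite -(size_map (@blade R n)) ltn_ord.
  rewrite [A == _](_ : _ = false) ?scaler0 //.
  apply: contraNF AD => /eqP ->; rewrite -mem_enum mem_nth //.
  by rewrite -(size_map (@blade R n)) ltn_ord.
rewrite [x]clifford_sum_cbasis memv_suml // => A _.
have [AD|/xD->] := boolP (A \in D); last by rewrite scale0r mem0v.
by apply/memvZ/memv_span; rewrite -bladeE map_f ?mem_enum.
Qed.

Lemma cmul_neq0 x y C : (x * y) C != 0 ->
  exists A, x A != 0 /\ y (symdiff A C) != 0.
Proof.
rewrite ffunE => /eqP nz.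
have /existsP[A /andP[? ?]] : [exists A, (x A != 0) && (y (symdiff A C) != 0)].
  apply: contraT; rewrite negb_exists => /forallP no; case: nz.
  apply: big1 => A _; move: (no A); rewrite negb_and !negbK.
  by case/orP=> /eqP ->; rewrite ?(mul0r, mulr0).
by exists A.
Qed.

(** A product of two blades is, up to sign, the blade of the symmetric difference, so supports
    multiply in the same way. *)
Lemma supportedM (p q r : pred {set 'I_n.+1}) x y :
  (forall A B, p A -> q B -> r (symdiff A B)) ->
  supported p x -> supported q y -> supported r (x * y).
Proof.
move=> pqr xp yq C; apply: contraNeq => /cmul_neq0[A [xA yAC]].
rewrite -[C](symdiffK A); apply: pqr.
  by apply: contraNT xA => /xp ->.
by apply: contraNT yAC => /yq ->.
Qed.

Lemma supported_cbasis (p : pred {set 'I_n.+1}) A :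
  p A -> supported p (cbasis R A).
Proof.
by move=> pA B pB; rewrite ffunE (_ : B == A = false) //;
  apply: contraNF pB => /eqP->.
Qed.

Lemma odd_symdiff A B : odd #|symdiff A B| = odd #|A| (+) odd #|B|.
Proof.
rewrite /symdiff cardsU (_ : _ :&: _ = set0) ?cards0 ?subn0; last first.
  by apply/setP=> i; rewrite !inE; case: (i \in A); case: (i \in B).
rewrite oddD -(cardsID B A) -[#|B|](cardsID A) !oddD [B :&: A]setIC.
by case: (odd _); case: (odd _); case: (odd _).
Qed.

Lemma symdiff_sub A B J : A \subset J -> B \subset J -> symdiff A B \subset J.
Proof. by move=> AJ BJ; rewrite subUset !(subset_trans (subsetDl _ _)). Qed.

(** Each blade with indices in J is a product of generators of the subalgebra. Conversely, the span
    of these blades contains 1 and is stable under left multiplication by the generators, so it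
    contains the generated algebra. *)
Lemma Cl_subE J : Cl_sub R J = <<[seq blade A | A <- enum (powerset J)]>>%VS.
Proof.
apply/eqP; rewrite eqEsubv; apply/andP; split; last first.
  apply/span_subvP => _ /mapP[A + ->]; rewrite mem_enum inE => AJ.
  rewrite /blade big_seq; apply: (big_ind (fun x => x \in Cl_sub R J)).
  - by rewrite memvE sub1_agenv.
  - by move=> x y xJ yJ; rewrite /Cl_sub agenvE memvM.
  move=> i; rewrite mem_enum => /(subsetP AJ) iJ.
  apply: (subvP (sub_agenv _)); apply: memv_span.
  by apply: map_f; rewrite mem_enum.
apply: agenv_sub_modl.
  rewrite -memvE; apply/mem_span_blade/supported_cbasis.
  by rewrite !inE sub0set.
apply/prodvP => x y xg /mem_span_blade yJ; apply/mem_span_blade.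
apply: (@supportedM (fun A => A \in powerset J) (fun A => A \in powerset J)) yJ.
  by move=> A B; rewrite !inE; apply: symdiff_sub.
apply/mem_span_blade; move: x xg; apply/subvP/span_subvP => _ /mapP[i + ->].
rewrite mem_enum => iJ; apply: memv_span.
by rewrite /gen -bladeE map_f // mem_enum inE sub1set.
Qed.

Definition graded J (b : bool) (A : {set 'I_n.+1}) :=
  (A \subset J) && (odd #|A| == b).

Lemma mem_Cl_sub J x : x \in Cl_sub R J <-> supported (fun A => A \subset J) x.
Proof.
rewrite Cl_subE; split=> [/mem_span_blade xJ A|xJ].
  by move=> AJ; apply: xJ; rewrite !inE.
by apply/mem_span_blade => A AJ; apply: xJ; rewrite !inE in AJ.
Qed.

(** The conditional is the one of [is_decomposition], so both parities of a coefficient are handled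
    at once. *)
Lemma mem_Cl_graded J (b : bool) x :
  x \in (if b then Cl_sub_odd R J else Cl_sub_even R J)
  <-> supported (graded J b) x.
Proof.
have -> : (if b then Cl_sub_odd R J else Cl_sub_even R J) =
    (Cl_sub R J :&: <<[seq blade A | A <- enum
      [set A : {set 'I_n.+1} | odd #|A| == b]]>>)%VS.
  case: b; rewrite /Cl_sub_odd /Cl_sub_even /Cl_odd /Cl_even.
    by rewrite (_ : [set A | _ == true] = [set A : {set 'I_n.+1} | odd #|A|]) //;
      apply/setP=> A; rewrite !inE eqb_id.
  by rewrite (_ : [set A | _ == false] = [set A : {set 'I_n.+1} | ~~ odd #|A|]) //;
    apply/setP=> A; rewrite !inE eqbF_neg.
rewrite memv_cap; split.
  case/andP=> /mem_Cl_sub xJ /mem_span_blade xb A.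
  by rewrite /graded negb_and => /orP[/xJ|Ab] //; apply: xb; rewrite !inE.
move=> xJ; apply/andP; split.
  by apply/mem_Cl_sub => A AJ; apply: xJ; rewrite /graded (negbTE AJ).
apply/mem_span_blade => A; rewrite !inE => Ab; apply: xJ.
by rewrite /graded negb_and Ab orbT.
Qed.

Lemma gradedM J b c x y : supported (graded J b) x -> supported (graded J c) y ->
  supported (graded J (b (+) c)) (x * y).
Proof.
apply: supportedM => A B /andP[AJ /eqP Ab] /andP[BJ /eqP Bc].
by rewrite /graded symdiff_sub // odd_symdiff Ab Bc eqxx.
Qed.

Lemma graded_prod_gen J (s : seq 'I_n.+1) : all (mem J) s ->
  supported (graded J (odd (size s))) (\prod_(i <- s) (gen i : Clifford R n)).
Proof.
elim: s => [|i s IH] /=.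
  rewrite big_nil => _; apply: supported_cbasis.
  by rewrite /graded sub0set cards0.
case/andP=> iJ /IH sJ; rewrite big_cons -addTb; apply: gradedM => //.
by apply: supported_cbasis; rewrite /graded sub1set cards1 iJ.
Qed.

Lemma gen_anticomm (i j : 'I_n.+1) : i != j ->
  gen i * gen j = - (gen j * gen i) :> Clifford R n.
Proof.
move=> ij; apply/eqP; rewrite -addr_eq0 gen_rel !mxE (negbTE ij).
by rewrite mulr0n mulr0 scale0r.
Qed.

Lemma gen_sq (i : 'I_n.+1) : i != ord0 -> gen i * gen i = -1 :> Clifford R n.
Proof.
move=> i0; apply: (scalerI (_ : 2 != 0 :> R)); first by rewrite pnatr_eq0.
rewrite scaler_nat mulr2n gen_rel !mxE eqxx mulr1n (negbTE i0).
by rewrite -scalerA scaleN1r.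
Qed.

Lemma gen_prod_anticomm (i : 'I_n.+1) (s : seq 'I_n.+1) : i \notin s ->
  gen i * \prod_(j <- s) gen j
    = (-1) ^+ size s * (\prod_(j <- s) gen j * gen i) :> Clifford R n.
Proof.
elim: s => [|j s IH]; first by rewrite big_nil !mulr1 !mul1r.
rewrite inE negb_or => /andP[ij /IH is_]; rewrite big_cons mulrA gen_anticomm //.
rewrite mulNr -[gen j * gen i * _]mulrA is_ exprS mulN1r !mulNr; congr (- _).
by rewrite [LHS]mulrA commr_sign -!mulrA.
Qed.

(** A generator with index outside J anticommutes with every factor of a blade in J, and the blades
    of x have an even number of factors. *)
Lemma even_comm_gen J (i : 'I_n.+1) x : i \notin J ->
  supported (graded J false) x -> x * gen i = gen i * x.
Proof.
move=> iJ xJ; rewrite [x]clifford_sum_cbasis mulr_suml mulr_sumr.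
apply: eq_bigr => A _; rewrite -scalerAl -scalerAr.
have [/andP[AJ]|/xJ ->] := boolP (graded J false A); last by rewrite !scale0r.
rewrite eqbF_neg => /negbTE evA; congr (_ *: _); rewrite -bladeE.
rewrite /blade gen_prod_anticomm.
  by rewrite -signr_odd -cardE evA mul1r.
by rewrite mem_enum; apply: contra iJ => /(subsetP AJ).
Qed.

(** No blade of x contains the index i and every blade of [y * gen i] does, so the two terms cannot
    cancel. *)
Lemma supported_mul_gen0 (i : 'I_n.+1) x y :
  x \in Cl_sub R (~: [set i]) -> y \in Cl_sub R (~: [set i]) ->
  x + y * gen i = 0 -> x = 0.
Proof.
move=> /mem_Cl_sub xi /mem_Cl_sub yi xy0; apply/ffunP => A; rewrite [RHS]ffunE.
have [iA|/xi//] := boolP (A \subset ~: [set i]).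
have /eqP := congr1 (fun z : Clifford R n => z A) xy0; rewrite !ffunE.
rewrite big1 ?addr0 => [/eqP//|B _].
rewrite ffunE; case: eqP => [BA|_]; last by rewrite !mulr0.
rewrite (yi B) ?mul0r ?mulr0 //.
have -> : B = symdiff A [set i].
  by rewrite -BA symdiffC -symdiffA symdiffv symdiff0r.
apply/subsetPn; exists i; last by rewrite !inE eqxx.
by move: iA; rewrite in_symdiff inE eqxx subsetC sub1set !inE => /negbTE ->.
Qed.

End Coordinates.

(** * The element xi *)

Section Projector.
Variables (R : realType) (n : nat).
Hypothesis hn : (2 <= n)%N.
Implicit Types (i j : 'I_n.+1) (s : seq 'I_n.+1) (x y : Clifford R n).

Lemma Cl_sub1 (J : {set 'I_n.+1}) : 1 \in Cl_sub R J.
Proof. by rewrite memvE sub1_agenv. Qed.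

Lemma Cl_subM (J : {set 'I_n.+1}) x y :
  x \in Cl_sub R J -> y \in Cl_sub R J -> x * y \in Cl_sub R J.
Proof. by rewrite /Cl_sub agenvE; apply: memvM. Qed.

Lemma Cl_sub_gen (J : {set 'I_n.+1}) i : i \in J -> gen i \in Cl_sub R J.
Proof.
by move=> iJ; apply/mem_Cl_sub/supported_cbasis; rewrite sub1set.
Qed.

Definition partner i : 'I_n.+1 := inord i.-1.

Lemma val_partner i : partner i = i.-1 :> nat.
Proof. by rewrite inordK // (leq_ltn_trans (leq_pred i)). Qed.

(** The property of indices outside J that the computations use: the partner i-1 is then odd and at
    least 3, hence distinct from 0, 1, 2 and from every pairable index. *)
Definition pairable i := ~~ odd i && (3 < i)%N.

Lemma neq_partner i j : pairable i -> pairable j -> i != partner j.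
Proof.
case/andP=> evi _ /andP[evj j3]; apply: contraNneq evi => ->.
by rewrite val_partner; case: (j : nat) j3 evj => //= k _; rewrite negbK.
Qed.

Lemma partner_eq i j : pairable i -> pairable j ->
  (partner i == partner j) = (i == j).
Proof.
case/andP=> _ i3 /andP[_ j3]; rewrite -!val_eqE /= !val_partner.
by case: (i : nat) i3 => // k; case: (j : nat) j3.
Qed.

Lemma neq12 i : (2 < i)%N -> (i != inord 1) && (i != inord 2).
Proof.
move=> i2; rewrite -!val_eqE /= !inordK ?ltnS ?(ltnW hn) //.
by case: (i : nat) i2 => [|[|[]]].
Qed.

Lemma bivI_gen i : (i != inord 1) && (i != inord 2) ->
  bivI * gen i = gen i * bivI :> Clifford R n.
Proof.
case/andP=> i1 i2; rewrite /bivI mulNr mulrN; congr (- _).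
rewrite mulrA [gen i * _]gen_anticomm // mulNr -!mulrA.
by rewrite [gen i * _]gen_anticomm // mulrN opprK.
Qed.

Lemma bivI_vecE : bivI * vecE = vecE * bivI :> Clifford R n.
Proof.
by apply: bivI_gen; rewrite -!val_eqE /= !inordK ?ltnS ?(ltnW hn).
Qed.

Lemma bivI_sq : bivI * bivI = -1 :> Clifford R n.
Proof.
have ne (k l : nat) : (k <= 2)%N -> (l <= 2)%N -> (k != l)%N ->
    inord k != inord l :> 'I_n.+1.
  by move=> k2 l2 kl; rewrite -val_eqE /= !inordK ?ltnS ?(leq_trans _ hn).
have e0 : ord0 = inord 0 :> 'I_n.+1 by apply: val_inj; rewrite /= inordK.
rewrite /bivI mulrNN mulrA -[gen _ * gen _ * gen _]mulrA.
rewrite [gen (inord 2) * _]gen_anticomm ?ne // mulrN mulrA gen_sq ?e0 ?ne //.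
by rewrite mulN1r opprK gen_sq ?e0 ?ne.
Qed.

Definition pair_unit i : Clifford R n := bivI * gen (partner i) * gen i.

(** [gen i] commutes with I and anticommutes with both generators of the pair, so the two signs
    cancel. *)
Lemma gen_pair_unit i j : (i != inord 1) && (i != inord 2) ->
  i != j -> i != partner j -> GRing.comm (gen i) (pair_unit j).
Proof.
move=> i12 ij ipj; rewrite /GRing.comm /pair_unit !mulrA -bivI_gen // -!mulrA.
congr (_ * _); rewrite mulrA [gen i * _]gen_anticomm // mulNr -!mulrA.
by rewrite [gen i * _]gen_anticomm // mulrN opprK.
Qed.

Lemma pairable12 i : pairable i -> (i != inord 1) && (i != inord 2).
Proof. by case/andP=> _ i3; apply/neq12/ltnW. Qed.

Lemma partner12 i : pairable i ->
  (partner i != inord 1) && (partner i != inord 2).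
Proof.
by case/andP=> _ i3; apply: neq12; rewrite val_partner; case: (i : nat) i3.
Qed.

Lemma pairable_neq0 i : pairable i -> (i != ord0) && (partner i != ord0).
Proof.
by case/andP=> _; rewrite -!val_eqE /= val_partner; case: (i : nat) => [|[]].
Qed.

Lemma bivI_pair_unit j : pairable j -> GRing.comm bivI (pair_unit j).
Proof.
move=> jp; apply: commrM; first apply: commrM => //.
  by apply: bivI_gen; apply: partner12.
by apply: bivI_gen; apply: pairable12.
Qed.

Definition projector s : Clifford R n := \prod_(i <- s) (1 + pair_unit i).

Lemma comm_projector x s : (forall j, j \in s -> GRing.comm x (pair_unit j)) ->
  x * projector s = projector s * x.
Proof.
move=> xs; rewrite /projector big_seq; apply: commr_prod => j js.
by apply: commrD; [apply: commr1|apply: xs].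
Qed.

Lemma vecE_projector s : all pairable s ->
  vecE * projector s = projector s * vecE.
Proof.
move=> /allP sp; apply: comm_projector => j /sp jp; apply: gen_pair_unit.
- by rewrite -!val_eqE /= !inordK ?ltnS ?(ltnW hn).
- by rewrite eq_sym; case/andP: (pairable_neq0 jp).
by rewrite eq_sym; case/andP: (pairable_neq0 jp).
Qed.

Lemma bivI_projector s : all pairable s ->
  bivI * projector s = projector s * bivI.
Proof.
by move=> /allP sp; apply: comm_projector => j /sp; apply: bivI_pair_unit.
Qed.

(** The factor with index i turns e^i into e^{i-1} I; all other factors commute with both
    elements. *)
Lemma gen_projector s i : all pairable s -> i \in s ->
  gen i * projector s = gen (partner i) * bivI * projector s.
Proof.
elim: s => //= j s IH /andP[jp sp]; rewrite inE /projector big_cons.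
have [-> _|ij /= is_] := eqVneq i j.
  (* With u = I e^{j-1} e^j one has e^j u = e^{j-1} I and e^{j-1} I u = e^j, so the two summands on
     one side are those on the other in reverse order. *)
  rewrite !mulrA; congr (_ * _); rewrite !mulrDr !mulr1 addrC; congr (_ + _).
    rewrite /pair_unit !mulrA -bivI_gen ?pairable12 // -[_ * gen j * _]mulrA.
    rewrite [gen j * _]gen_anticomm ?neq_partner // mulrN mulNr.
    rewrite -!mulrA gen_sq; last by case/andP: (pairable_neq0 jp).
    by rewrite mulrN1 [bivI * - _]mulrN opprK bivI_gen ?partner12.
  rewrite /pair_unit -bivI_gen ?partner12 // !mulrA -[_ * gen _ * bivI]mulrA.
  rewrite -bivI_gen ?partner12 // !mulrA bivI_sq mulN1r !mulNr.
  rewrite gen_sq ?mulN1r ?opprK //; by case/andP: (pairable_neq0 jp).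
have ip := allP sp _ is_.
rewrite mulrA (_ : gen i * _ = (1 + pair_unit j) * gen i); last first.
  by rewrite mulrDr mulrDl mul1r mulr1 gen_pair_unit ?pairable12 ?neq_partner.
have cw : GRing.comm (gen (partner i) * bivI) (1 + pair_unit j).
  apply: commrD; first exact: commr1.
  apply/commr_sym/commrM; apply/commr_sym; last exact: bivI_pair_unit.
  by apply: gen_pair_unit; rewrite ?partner12 ?partner_eq // eq_sym neq_partner.
by rewrite -mulrA [gen i * _]IH // [RHS]mulrA cw -[RHS]mulrA.
Qed.

(** This is where the shifted indices and the power of I in the formula for hat Psi come from: next
    to xi, each e^i may be exchanged for e^{i-1} I. *)
Lemma prod_gen_projector s t : all pairable t -> uniq s -> {subset s <= t} ->
  \prod_(i <- s) gen i * projector t =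
  \prod_(i <- s) gen (partner i) * bivI ^+ size s * projector t.
Proof.
move=> tp; elim: s => [|i s IH] /=; first by rewrite !big_nil expr0 mulr1.
case/andP=> is_ us st; have it : i \in t by rewrite st ?mem_head.
have {}st : {subset s <= t} by move=> j js; rewrite st // inE js orbT.
have ip := allP tp _ it.
have sp j : j \in s -> pairable j by move=> /st /(allP tp).
have anti (k : 'I_n.+1) : k \notin map partner s ->
    gen k * \prod_(j <- s) gen (partner j)
    = (-1) ^+ size s * (\prod_(j <- s) gen (partner j) * gen k) :> Clifford R n.
  by rewrite -(big_map partner predT (@gen R n)) => /gen_prod_anticomm ->;
    rewrite size_map.
have i_no : i \notin map partner s.
  by apply/mapP => -[j /sp jp ij]; have := neq_partner ip jp; rewrite ij eqxx.
have pi_no : partner i \notin map partner s.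
  apply/mapP => -[j js /eqP]; rewrite (partner_eq ip (sp _ js)) => /eqP ij.
  by move: is_; rewrite ij js.
have cI (k : 'I_n.+1) l : (k != inord 1) && (k != inord 2) ->
    bivI ^+ l * gen k = gen k * bivI ^+ l :> Clifford R n.
  by move=> k12; apply/esym/commrX/esym/bivI_gen.
(* The induction hypothesis comes first; then e^i on the left and e^{i-1} on the right both move
   past the remaining partners. They pick up the same sign, and e^i can then be brought next to
   xi. *)
rewrite !big_cons -!mulrA IH // !mulrA anti // anti //.
rewrite -!mulrA; congr (_ * (_ * _)); rewrite !mulrA -cI ?pairable12 //.
rewrite -mulrA gen_projector // !mulrA cI ?partner12 //.
by rewrite exprSr !mulrA.
Qed.

Lemma bivI_mem (J : {set 'I_n.+1}) : inord 1 \in J -> inord 2 \in J ->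
  bivI \in Cl_sub R J.
Proof. by move=> J1 J2; rewrite rpredN; apply: Cl_subM; apply: Cl_sub_gen. Qed.

Lemma bivI_partner_mem i j : pairable i -> pairable j ->
  bivI * gen (partner j) \in Cl_sub R (~: [set i]).
Proof.
move=> ip jp; have /andP[i1 i2] := pairable12 ip; apply: Cl_subM.
  by apply: bivI_mem; rewrite !inE eq_sym.
by apply: Cl_sub_gen; rewrite !inE eq_sym neq_partner.
Qed.

(** With X the product of x and all factors but the last, the hypothesis reads X + (X I e^{i-1}) e^i
    = 0. Since e^i occurs neither in X nor in X I e^{i-1}, this forces X = 0, and induction removes
    the other factors. *)
Lemma projector_inj s x : uniq s -> all pairable s ->
  (forall i, i \in s -> x \in Cl_sub R (~: [set i])) ->
  x * projector s = 0 -> x = 0.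
Proof.
elim/last_ind: s => [|s i IH]; first by rewrite /projector big_nil mulr1.
rewrite rcons_uniq all_rcons => /andP[is_ us] /andP[ip sp] xs.
rewrite /projector -cats1 big_cat big_seq1 /= -/(projector s) mulrA mulrDr mulr1.
rewrite /pair_unit [x * _ * (_ * _)]mulrA => x0; apply: IH => //.
  by move=> j js; apply: xs; rewrite mem_rcons inE js orbT.
have xm : x * projector s \in Cl_sub R (~: [set i]).
  apply: Cl_subM; first by apply: xs; rewrite mem_rcons mem_head.
  rewrite /projector big_seq; apply: (big_ind (fun y => y \in Cl_sub R _)).
  - exact: Cl_sub1.
  - by move=> y z; apply: Cl_subM.
  move=> j js; rewrite rpredD ?Cl_sub1 //; apply: Cl_subM.
    exact/bivI_partner_mem/(allP sp).
  by apply: Cl_sub_gen; rewrite !inE; apply: contraNneq is_ => <-.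
apply: supported_mul_gen0 x0 => //; apply: Cl_subM => //.
exact: bivI_partner_mem.
Qed.

End Projector.

(** * Derivatives and linear maps *)

Section Calculus.
Variables (R : realType) (n : nat).
Implicit Types (A B : {set 'I_n.+1}) (f : 'cV[R]_n.+1 -> Clifford R n).

Lemma differentiable_big (V W : normedModType R) (I : Type) (s : seq I)
    (F : I -> V -> W) (x : V) : (forall i, differentiable (F i) x) ->
  differentiable (fun y => \sum_(i <- s) F i y) x.
Proof.
move=> dF; elim: s => [|i s IH].
  rewrite (_ : (fun _ => _) = cst 0); first exact: differentiable_cst.
  by apply/boolp.funext => y; rewrite big_nil.
rewrite (_ : (fun _ => _) = F i + (fun y => \sum_(i <- s) F i y)).
  exact: differentiableD.
by apply/boolp.funext => y; rewrite big_cons.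
Qed.

Lemma derive_big (V W : normedModType R) (I : Type) (s : seq I)
    (F : I -> V -> W) (x v : V) : (forall i, differentiable (F i) x) ->
  'D_v (fun y => \sum_(i <- s) F i y) x = \sum_(i <- s) 'D_v (F i) x.
Proof.
move=> dF; elim: s => [|i s IH].
  rewrite (_ : (fun _ => _) = cst 0) ?derive_cst ?big_nil //.
  by apply/boolp.funext => y; rewrite big_nil.
rewrite (_ : (fun _ => _) = F i + (fun y => \sum_(i <- s) F i y)).
  rewrite deriveD ?IH ?big_cons //; apply: diff_derivable => //.
  exact: differentiable_big.
by apply/boolp.funext => y; rewrite big_cons.
Qed.

(** Derivatives are taken coordinatewise, so a linear map has to be seen as a finite sum of
    coordinates with constant coefficients. *)
Lemma linear_coord (h : {linear Clifford R n -> Clifford R n})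
    (X : Clifford R n) A :
  h X A = \sum_B (h (cbasis R B) A : R) * (X B : R).
Proof.
rewrite {1}[X]clifford_sum_cbasis linear_sum sum_ffunE; apply: eq_bigr => B _.
by rewrite linearZ ffunE mulrC.
Qed.

Lemma Cl_differentiable_linear (h : {linear Clifford R n -> Clifford R n}) f :
  Cl_differentiable f -> Cl_differentiable (fun y => h (f y)).
Proof.
move=> df A x; under boolp.eq_fun do rewrite linear_coord.
by apply: differentiable_big => B; apply: differentiableZ.
Qed.

Lemma partial_linear (h : {linear Clifford R n -> Clifford R n}) f mu x :
  Cl_differentiable f ->
  partial mu (fun y => h (f y)) x = h (partial mu f x).
Proof.
move=> df; apply/ffunP => A; rewrite ffunE linear_coord.
under boolp.eq_fun do rewrite linear_coord.
rewrite derive_big => [|B]; last exact: differentiableZ.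
apply: eq_bigr => B _; rewrite ffunE.
have dB := @diff_derivable _ _ _ _ _ (delta_mx mu 0) (df B x).
exact: (deriveZ (h (cbasis R B) A) dB).
Qed.

Lemma Cl_differentiable_mulmx (M : 'M[R]_n.+1) f :
  Cl_differentiable f -> Cl_differentiable (fun y => f (M *m y)).
Proof.
move=> df A x; apply: (@differentiable_comp _ _ _ _ (fun y => M *m y)
  (fun y => f y A : R)) => //.
rewrite (_ : mulmx M = fun y => \sum_j y j 0 *: col j M).
  apply: differentiable_big => j; apply: differentiableZl.
  exact: differentiable_coord.
apply/boolp.funext => y; apply/matrixP => i j.
by rewrite !mxE summxE; apply: eq_bigr => k _; rewrite !mxE (ord1 j) mulrC.
Qed.

(** A coordinate that vanishes identically has zero derivative; this keeps the derivatives of a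
    Q'-valued function in Q', with the same parity. *)
Lemma partial_supported (p : pred {set 'I_n.+1}) f mu x :
  (forall y, supported p (f y)) -> supported p (partial mu f x).
Proof.
move=> fp A pA; rewrite ffunE (_ : (fun y => _) = cst 0) ?derive_cst //.
by apply/boolp.funext => y; apply: fp.
Qed.

End Calculus.

(** * Left multiplication modulo the annihilator of xi *)

Section Lift.
Variables (R : realType) (n : nat).
Hypothesis hn : (2 <= n)%N.
Variable J : {set 'I_n.+1}.
Hypotheses (J1 : inord 1 \in J) (J2 : inord 2 \in J).
Hypothesis JC_pairable : forall i, i \notin J -> pairable i.
Hypothesis partnerJ : forall i, i \notin J -> partner i \in J.
Implicit Types (x y : Clifford R n) (M : {set 'I_n.+1}).

Let xi : Clifford R n := projector R (enum (~: J)).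

Let xi_pairable : all (@pairable n) (enum (~: J)).
Proof. by apply/allP => i; rewrite mem_enum inE => /JC_pairable. Qed.

(** The formula for hat Psi as a map of the value Psi(x) alone. Its linearity lets derivatives pass
    through it. *)
Definition spinor_lift (c : {set 'I_n.+1} -> Clifford R n) x : Clifford R n :=
  c set0 * x
  + \sum_(M : {set 'I_n.+1} | (M \subset ~: J) && (M != set0))
      c M * x * (\prod_(i <- enum M) gen (partner i)) * bivI ^+ #|M|.

Fact spinor_lift_linear c : linear (spinor_lift c).
Proof.
move=> k x y; rewrite /spinor_lift scalerDr scaler_sumr addrACA -big_split.
rewrite mulrDr -scalerAr; congr (_ + _); apply: eq_bigr => M _ /=.
by rewrite mulrDr !mulrDl -scalerAr !scalerAl.
Qed.

HB.instance Definition _ c := GRing.isLinear.Build R (Clifford R n)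
  (Clifford R n) _ (spinor_lift c) (spinor_lift_linear c).

Lemma even_supported x : x \in Cl_sub_even R J <-> supported (graded J false) x.
Proof. exact: (mem_Cl_graded J false). Qed.

Lemma bivI_graded : supported (graded J false) (bivI : Clifford R n).
Proof.
apply/even_supported; rewrite rpredN; apply/even_supported.
have := @graded_prod_gen R n J [:: inord 1; inord 2].
rewrite big_cons big_seq1; apply; apply/allP => i.
by rewrite !inE => /orP[] /eqP ->.
Qed.

Lemma bivIX_graded k : supported (graded J false) (bivI ^+ k : Clifford R n).
Proof.
elim: k => [|k IH]; last first.
  rewrite exprS -[false]addFb; apply: gradedM => //; exact: bivI_graded.
by apply: supported_cbasis; rewrite /graded sub0set cards0.
Qed.

Lemma prod_partner_graded M : M \subset ~: J ->
  supported (graded J (odd #|M|))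
    (\prod_(i <- enum M) gen (partner i) : Clifford R n).
Proof.
move=> MJ; rewrite cardE -(size_map (@partner n)) -(big_map _ predT (@gen R n)).
apply: graded_prod_gen; apply/allP => _ /mapP[i + ->].
by rewrite mem_enum => /(subsetP MJ); rewrite inE => /partnerJ.
Qed.

Lemma spinor_lift_even S c x : is_decomposition J S c ->
  x \in Cl_sub_even R J -> spinor_lift c x \in Cl_sub_even R J.
Proof.
case=> cJ _ /even_supported xJ; rewrite rpredD //.
  apply/even_supported; rewrite -[false]addFb; apply: gradedM => //.
  by apply/even_supported; have := cJ set0; rewrite sub0set cards0; apply.
rewrite rpred_sum // => M /andP[MJ _]; apply/even_supported.
rewrite -[false]addbF; apply: gradedM; last exact: bivIX_graded.
(* The coefficient and the product of partners both have the parity of [#|M|], so together they are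
   even. *)
rewrite -(addbb (odd #|M|)); apply: gradedM; last exact: prod_partner_graded.
rewrite -[odd #|M|]addbF; apply: gradedM => //.
exact/mem_Cl_graded/cJ.
Qed.

Lemma spinor_lift_projector S c x : is_decomposition J S c ->
  x \in Cl_sub_even R J -> spinor_lift c x * xi = S * x * xi.
Proof.
case=> _ -> /even_supported xJ; rewrite /spinor_lift !mulrDl; congr (_ + _).
rewrite !mulr_suml; apply: eq_bigr => M /andP[MJ _].
have xM : x * blade M = blade M * x.
  rewrite /blade big_seq; apply: commr_prod => i; rewrite mem_enum.
  by move=> /(subsetP MJ); rewrite inE => iJ; apply: even_comm_gen iJ xJ.
rewrite -[c M * blade M * x]mulrA -xM -!mulrA; congr (_ * (_ * _)).
rewrite mulrA cardE /blade prod_gen_projector ?enum_uniq // => i.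
by rewrite !mem_enum; apply: (subsetP MJ).
Qed.

(** Common pointwise form of both equations: [A] stands for the covariant derivatives and [x] for
    the value of the spinor. The second sum runs over i = mu+1 outside J instead of mu in K. *)
Definition dirac (m : R) (A : 'I_n.+1 -> Clifford R n) x : Clifford R n :=
  \sum_(mu in J) gen mu * A mu * vecE
  + \sum_(i in ~: J) A i * gen (partner i) * vecE * bivI + m *: (x * bivI).

(** For i outside J, A_i e^{i-1} E I xi = A_i e^{i-1} I xi E = A_i e^i xi E = e^i A_i xi E. The two
    sums thus merge into one over all indices, on which P can act. *)
Lemma dirac_projector m A x : (forall mu, A mu \in Cl_sub_even R J) ->
  dirac m A x * xi =
  (\sum_mu gen mu * (A mu * xi)) * vecE + m *: (x * xi * bivI).
Proof.
move=> AJ; rewrite /dirac !mulrDl -scalerAl -[x * bivI * _]mulrA.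
rewrite bivI_projector // [x * (_ * _)]mulrA; congr (_ + _).
rewrite [in RHS](bigID (mem J)) mulrDl /= !mulr_suml; congr (_ + _).
  apply: eq_bigr => mu _; rewrite -[_ * vecE * xi]mulrA vecE_projector //.
  by rewrite !mulrA.
rewrite (eq_bigl (fun i => i \notin J)) => [|i]; last by rewrite inE.
apply: eq_bigr => i iJ; have ip := JC_pairable iJ.
have /even_supported Ai := AJ i.
rewrite [gen i * _]mulrA -(even_comm_gen iJ Ai) -[A i * gen i * _]mulrA.
rewrite gen_projector ?mem_enum ?inE //.
rewrite -[_ * vecE * bivI]mulrA -bivI_vecE // -!mulrA.
by rewrite [vecE * _]vecE_projector.
Qed.

Lemma even_projector_inj x : x \in Cl_sub R J -> x * xi = 0 -> x = 0.
Proof.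
move=> /mem_Cl_sub xJ; apply: projector_inj => //; first exact: enum_uniq.
move=> i; rewrite mem_enum inE => iJ; apply/mem_Cl_sub => A iA; apply: xJ.
by apply: contra iA => /subset_trans; apply; rewrite subsetC sub1set inE.
Qed.

(** Places the expression in Q', so that its vanishing can be tested after multiplication by xi. *)
Lemma dirac_mem m A x : ord0 \in J -> (forall mu, A mu \in Cl_sub_even R J) ->
  x \in Cl_sub_even R J -> dirac m A x \in Cl_sub R J.
Proof.
have sub y : y \in Cl_sub_even R J -> y \in Cl_sub R J.
  by rewrite memv_cap => /andP[].
move=> J0 AJ /sub xJ; have EJ : vecE \in Cl_sub R J by apply: Cl_sub_gen.
have IJ := bivI_mem R J1 J2.
rewrite !rpredD //; last by apply/memvZ/Cl_subM.
  apply: memv_suml => mu muJ; do 2?[apply: Cl_subM => //]; last exact/sub.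
  exact: Cl_sub_gen.
apply: memv_suml => i; rewrite inE => iJ; do 3?[apply: Cl_subM => //].
  exact/sub.
exact/Cl_sub_gen/partnerJ.
Qed.

End Lift.

(** * The index sets J and K *)

Section Indices.
Variables (d : nat) (sc : spinor_case).
Hypothesis hd : (2 <= d)%N.

Let d2 : (2 <= 2 * d)%N.
Proof. by apply: leq_trans hd _; rewrite leq_pmull. Qed.

Lemma index_J_low k : (k <= 2)%N -> (inord k : 'I_(2 * d).+1) \in index_J sc d.
Proof.
move=> k2; have kd : (k < (2 * d).+1)%N by rewrite ltnS (leq_trans k2).
by rewrite inE inordK //; case: sc; rewrite k2.
Qed.

Lemma index_J_pairable (i : 'I_(2 * d).+1) : i \notin index_J sc d -> pairable i.
Proof.
rewrite inE /pairable ltn_neqAle; case: sc; rewrite !negb_or -ltnNge.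
  (* The bound i > 2 improves to i > 3 because i is even. *)
  by case/andP=> i2 ev; rewrite ev i2 andbT; apply: contraNneq ev => <-.
by case/and3P=> i2 ev _; rewrite ev i2 andbT; apply: contraNneq ev => <-.
Qed.

Lemma odd_partner (i : 'I_(2 * d).+1) : pairable i -> odd (partner i).
Proof.
case/andP=> ev; rewrite val_partner.
by case: (i : nat) ev => //= k; rewrite negbK.
Qed.

Lemma partner_index_J (i : 'I_(2 * d).+1) :
  i \notin index_J sc d -> partner i \in index_J sc d.
Proof.
by move/index_J_pairable/odd_partner; rewrite inE => ->; case: sc; rewrite orbT.
Qed.

Lemma inord_partnerS (i : 'I_(2 * d).+1) : pairable i -> inord (partner i).+1 = i.
Proof.
case/andP=> _ i3; apply: val_inj; rewrite /= val_partner prednK ?inordK //.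
exact: leq_trans i3.
Qed.

(** The complement of J consists of the even indices from 4 to 2d, or to 2d-2 in the double spinor
    case, where 2d belongs to J; lowering them by one gives K. *)
Lemma index_K_partner :
  index_K sc d = [set partner i | i in ~: index_J sc d].
Proof.
apply/setP => j; apply/idP/imsetP => [jK|[i iJ ->]].
  have [oj j3 jd] : [/\ odd j, (2 < j)%N & match sc with
     SemiSpinor => (j < 2 * d)%N | DoubleSpinor => (j.+1 < 2 * d)%N end].
    move: jK; rewrite inE => /and3P[oj j3 jd]; split=> //.
    by case: sc jd; lia.
  have jS : (j.+1 < (2 * d).+1)%N by case: sc jd; lia.
  exists (inord j.+1); last by apply: val_inj; rewrite /= val_partner inordK.
  rewrite !inE inordK //; case: sc jd => jd; rewrite /= oj !negb_or -ltnNge /=.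
    lia.
  lia.
have ip : pairable i by apply: index_J_pairable; rewrite inE in iJ.
rewrite inE odd_partner // val_partner.
move: iJ ip (ltn_ord i); rewrite !inE /pairable; case: sc; lia.
Qed.

End Indices.

(** * The Dirac--Hestenes equation *)

Section Equations.
Variables (R : realType) (d : nat) (sc : spinor_case).
Hypothesis hd : (2 <= d)%N.
Local Notation n := (2 * d)%N.
Local Notation J := (index_J sc d).
Implicit Types (f : 'cV[R]_n.+1 -> Clifford R n) (a : 'cV[R]_n.+1 -> 'rV[R]_n.+1).

Let hn : (2 <= n)%N.
Proof. by apply: leq_trans hd _; rewrite leq_pmull. Qed.

(** The two arguments of [F] separate the index mu+1 of the derivative from the index mu of the
    generator. *)
Lemma sum_index_K (V : nmodType) (F : 'I_n.+1 -> 'I_n.+1 -> V) :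
  \sum_(mu in index_K sc d) F (inord mu.+1) mu = \sum_(i in ~: J) F i (partner i).
Proof.
have Jp i : i \in ~: J -> pairable i by rewrite inE => /index_J_pairable.
rewrite index_K_partner // big_imset /= => [|i j /Jp ip /Jp jp /eqP].
  by apply: eq_bigr => i /Jp ip; rewrite inord_partnerS.
by rewrite partner_eq // => /eqP.
Qed.

Lemma Dirac_Hestenes_dirac m a f : Dirac_Hestenes sc m a f <->
  forall x, dirac J m (covD a f ^~ x) (f x) = 0.
Proof.
by split=> h x; rewrite -[RHS](h x) /dirac
  (sum_index_K (fun i j => covD a f i x * gen j * vecE * bivI)).
Qed.

(** I commutes with E and with e^{i-1}, since i-1 is at least 3, so it may be moved from before
    these factors to the end. *)
Lemma transformed_Dirac_Hestenes_dirac m a f :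
  transformed_Dirac_Hestenes sc m a f <->
  forall x, dirac J m (covD a f ^~ x) (f x) = 0.
Proof.
have E x : \sum_(mu in index_K sc d)
      covD a f (inord mu.+1) x * bivI * gen mu * vecE
    = \sum_(i in ~: J) covD a f i x * gen (partner i) * vecE * bivI.
  rewrite (sum_index_K (fun i j => covD a f i x * bivI * gen j * vecE)).
  apply: eq_bigr => i; rewrite inE => /index_J_pairable ip.
  rewrite -[_ * bivI * _]mulrA bivI_gen ?partner12 //.
  by rewrite -!mulrA bivI_vecE.
by split=> h x; rewrite -[RHS](h x) E.
Qed.

Lemma covD_even a f mu x : (forall y, f y \in Cl_sub_even R J) ->
  covD a f mu x \in Cl_sub_even R J.
Proof.
move=> fJ; apply: rpredD.
  by apply/even_supported/partial_supported => y; apply/even_supported.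
apply: memvZ; apply/even_supported; rewrite -[false]addFb; apply: gradedM.
  exact/even_supported.
by apply: bivI_graded; apply: index_J_low.
Qed.

End Equations.

Unset Implicit Arguments.

Theorem theorem5p5 (R : realType) (d : nat) (hd : (2 <= d)%N)
    (sc : spinor_case)
    (P : 'M[R]_((2 * d).+1)) (hP : in_SO P)
    (S : Clifford R (2 * d)) (hS : in_Spin S)
    (hSP : forall mu : 'I_(2 * d).+1,
       S^-1 * gen mu * S = \sum_nu P mu nu *: gen nu)
    (c : {set 'I_(2 * d).+1} -> Clifford R (2 * d))
    (hc : is_decomposition (index_J sc d) S c)
    (m : R) (a : 'cV[R]_((2 * d).+1) -> 'rV[R]_((2 * d).+1))
    (Psi : 'cV[R]_((2 * d).+1) -> Clifford R (2 * d))
    (hPsi : differentiable_spinor sc Psi)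
    (hDH : Dirac_Hestenes sc m a Psi) :
  differentiable_spinor sc (hat_Psi (index_J sc d) P c Psi)
  /\ transformed_Dirac_Hestenes sc m (hat_a P a)
       (hat_Psi (index_J sc d) P c Psi).
Proof.
case: hPsi hDH => dPsi PsiJ /(Dirac_Hestenes_dirac sc hd) hDH.
have hn : (2 <= 2 * d)%N by rewrite (leq_trans hd) ?leq_pmull.
set J := index_J sc d in hc PsiJ hDH *.
have J1 : inord 1 \in J by apply: index_J_low.
have J2 : inord 2 \in J by apply: index_J_low.
have e0 : ord0 = inord 0 :> 'I_(2 * d).+1 by apply: val_inj; rewrite /= inordK.
have J0 : ord0 \in J by rewrite e0; apply: index_J_low.
have JC : forall i, i \notin J -> pairable i by exact: index_J_pairable.
have pJ : forall i, i \notin J -> partner i \in J by exact: partner_index_J.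
have Su : S \is a GRing.unit by case: hS.
have Pu : P \in unitmx by rewrite unitmxE (proj2 hP) unitr1.
set hPsi := hat_Psi J P c Psi.
have hatE x : hPsi x = spinor_lift J c (Psi (invmx P *m x)) by [].
have hatPE x : hPsi (P *m x) = spinor_lift J c (Psi x).
  by rewrite hatE mulmxA mulVmx // mul1mx.
have dhat : Cl_differentiable hPsi.
  have dlift := Cl_differentiable_linear (spinor_lift J c) dPsi.
  exact: Cl_differentiable_mulmx dlift.
have hatJ x : hPsi x \in Cl_sub_even R J.
  by rewrite hatE; apply: spinor_lift_even hc _.
split=> //; apply/(transformed_Dirac_Hestenes_dirac sc hd) => xh.
(* Every point is the image under P of its original coordinates, where the hypothesis on Psi is
   available. *)
have [x ->] : exists x, xh = P *m x.
  by exists (invmx P *m xh); rewrite mulmxA mulmxV // mul1mx.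
set xi := projector R (enum (~: J)).
have lift_xi y : y \in Cl_sub_even R J -> spinor_lift J c y * xi = S * y * xi.
  exact: spinor_lift_projector hc.
have xip : all (@pairable _) (enum (~: J)).
  by apply/allP => i; rewrite mem_enum inE => /JC.
have covJ mu : covD a Psi mu x \in Cl_sub_even R J by apply: covD_even.
have hcovJ mu : covD (hat_a P a) hPsi mu (P *m x) \in Cl_sub_even R J.
  exact: covD_even.
(* Derivative and potential transform by the same matrix Q, so the whole covariant derivative does,
   with S in front once xi is on the right. *)
have hcov_xi mu : covD (hat_a P a) hPsi mu (P *m x) * xi =
    \sum_nu invmx P nu mu *: (S * covD a Psi nu x * xi).
  rewrite /covD partial_hat // /hat_a mulmxA mulVmx // mul1mx mxE.
  rewrite mulrDl mulr_suml -scalerAl -mulrA bivI_projector // mulrA hatPE.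
  rewrite lift_xi // scaler_suml -big_split; apply: eq_bigr => nu _ /=.
  rewrite mulrDr mulrDl scalerDr; congr (_ + _).
    rewrite (_ : (fun y => _) = (fun y => spinor_lift J c (Psi y))); last first.
      by apply/boolp.funext => y; rewrite hatPE.
    rewrite partial_linear // -scalerAl lift_xi //.
    by apply/even_supported/partial_supported => y; apply/even_supported.
  by rewrite -scalerA -!scalerAr -!scalerAl -!mulrA bivI_projector.
(* The relation between S and P, contracted with Q: q^nu_mu p^mu_la is the Kronecker delta. *)
have gen_S nu : \sum_mu invmx P nu mu *: (gen mu * S) = S * gen nu.
  under eq_bigr => mu _ do
    rewrite -[gen mu * S](mulVKr Su) [S^-1 * _]mulrA hSP scalerAr.
  rewrite -mulr_sumr; congr (_ * _).
  under eq_bigr => mu _ do rewrite scaler_sumr.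
  have QP la : \sum_mu invmx P nu mu * P mu la = (nu == la)%:R.
    by have /matrixP/(_ nu la) := mulVmx Pu; rewrite !mxE.
  rewrite exchange_big /=.
  rewrite (eq_bigr (fun la => (nu == la)%:R *: gen la)) => [|la _]; last first.
    by rewrite -QP scaler_suml; apply: eq_bigr => mu _; rewrite scalerA.
  rewrite (bigD1 nu) //= big1 ?addr0 ?eqxx ?scale1r // => la nla.
  by rewrite eq_sym (negbTE nla) scale0r.
apply: (even_projector_inj hn JC); first exact: dirac_mem.
rewrite dirac_projector // hatPE.
under eq_bigr => mu _ do rewrite hcov_xi mulr_sumr.
rewrite exchange_big lift_xi //=.
(* The matrix Q from the covariant derivatives is absorbed while S moves to the left of the
   generators. *)
have -> : \sum_nu \sum_mu gen mu * (invmx P nu mu *: (S * covD a Psi nu x * xi))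
    = S * \sum_nu gen nu * (covD a Psi nu x * xi).
  rewrite mulr_sumr; apply: eq_bigr => nu _; rewrite mulrA -gen_S mulr_suml.
  by apply: eq_bigr => mu _; rewrite -scalerAr -scalerAl !mulrA.
(* What remains is the original equation multiplied by S on the left and by xi on the right. *)
have := congr1 (fun y => S * (y * xi)) (hDH x).
by rewrite dirac_projector // mul0r mulr0 mulrDr -scalerAr !mulrA.
Qed.
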